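(* Let $n\ge 1$ and let $\Delta=(\Delta_{ij})$ be an integer $n\times n$ matrix such that $\det\Delta\neq 0$, $\Delta_{ij}\le 0$ for all $i\ne j$, and there exists a vector $\mathbf r\in\mathbb Z^n$ with $\mathbf r>0$ and $\mathbf r\Delta\ge 0$. Then the number of $\Delta$-parking functions is less than or equal to $\det\Delta$.
   Context: Vectors are row vectors. $\mathbf r>0$ means $r_i>0$ for all $i$; $\mathbf r\ge \mathbf r'$ means $r_i\ge r'_i$ for all $i$. $\mathscr R(\Delta)=\{\mathbf r\in\mathbb Z^n : \mathbf r>0,\ \mathbf r\Delta\ge 0\}$. For $\mathbf r\in\mathscr R(\Delta)$, $\Omega(\mathbf r)$ is the set of integer vectors $\chi=(\chi(1),\dots,\chi(n))$ with $0\le\chi(i)\le r_i$ for every $i$ and $\chi(i)\ne 0$ for some $i$. $\Delta^j$ is the $j$-th column of $\Delta$, and $\langle X,Y\rangle=\sum_{i=1}^n X_iY_i$. A $(\Delta,\mathbf r)$-parking function is a function $f:\{1,\dots,n\}\to\{0,1,2,\dots\}$ such that for every $\chi\in\Omega(\mathbf r)$ there exists $j$ with $\chi(j)\ge 1$ and $0\le f(j)<\langle\chi,\Delta^j\rangle$. The set of $(\Delta,\mathbf r)$-parking functions is the same for all $\mathbf r\in\mathscr R(\Delta)$; its elements are called $\Delta$-parking functions. *)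

(* Defs.v *)
From mathcomp Require Import all_boot all_order all_algebra.
From mathcomp Require Import finmap.
From mathcomp Require Import boolp classical_sets cardinality.
Set Implicit Arguments.
Unset Strict Implicit.
Unset Printing Implicit Defensive.
Import Order.TTheory GRing.Theory Num.Theory.
Local Open Scope classical_set_scope.
Local Open Scope ring_scope.

Definition dot (n : nat) (X : 'rV[int]_n) (Y : 'cV[int]_n) : int :=
  \sum_(i < n) X 0 i * Y i 0.

Definition Rset (n : nat) (Delta : 'M[int]_n) : set 'rV[int]_n :=
  [set r : 'rV[int]_n | (forall i : 'I_n, 0 < r 0 i) /\
                     (forall j : 'I_n, 0 <= (r *m Delta) 0 j)].

Definition Omega (n : nat) (r : 'rV[int]_n) : set 'rV[int]_n :=
  [set chi : 'rV[int]_n | (forall i : 'I_n, 0 <= chi 0 i <= r 0 i) /\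
                       (exists i : 'I_n, chi 0 i <> 0)].

Definition parking_wrt (n : nat) (Delta : 'M[int]_n) (r : 'rV[int]_n)
    (f : {ffun 'I_n -> nat}) : Prop :=
  forall chi : 'rV[int]_n, Omega r chi ->
    exists j : 'I_n, 1 <= chi 0 j /\ 0 <= (f j)%:Z < dot chi (col j Delta).

(* When the off-diagonal entries of Delta are nonpositive, [parking_wrt Delta r]
   is the same for all r in R(Delta); for nonempty R(Delta), "some r" and
   "every r" then define the same set. *)
Definition parking_functions (n : nat) (Delta : 'M[int]_n) :
    set {ffun 'I_n -> nat} :=
  [set f | exists2 r : 'rV[int]_n, Rset Delta r & parking_wrt Delta r f].

(* Main.v *)
Require Import Defs.
From mathcomp Require Import all_boot all_order all_algebra.
From mathcomp Require Import finmap.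
From mathcomp Require Import boolp classical_sets cardinality.
From mathcomp Require Import lra.
Set Implicit Arguments.
Unset Strict Implicit.
Unset Printing Implicit Defensive.
Import Order.TTheory GRing.Theory Num.Theory.
Local Open Scope classical_set_scope.
Local Open Scope ring_scope.

(** Two distinct Delta-parking functions are never congruent modulo the lattice
    spanned by the rows of Delta: if [f - g = z Delta] then [z Delta <= f] and
    [- z Delta <= g], and the parking condition applied to the positive parts of
    [z] and [-z] forces [z = 0].  By the Smith normal form there are at most
    [`|\det Delta|] residue classes modulo that lattice, and an induction on
    Schur complements shows [\det Delta >= 0]. *)

(** Pivot on the corner entry [a], which is nonnegative. If [a] is nonzero, the Schur complement [S]
    keeps nonpositive off-diagonal entries, since [c] and [b] are both nonpositive, and the tail
    [r'] of [r] still satisfies [r' S >= 0]. *)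
Lemma det_Zmatrix_ge0 (F : realFieldType) (n : nat) (M : 'M[F]_n)
    (r : 'rV[F]_n) :
  (forall i j, i != j -> M i j <= 0) -> (forall i, 0 < r 0 i) ->
  (forall j, 0 <= (r *m M) 0 j) -> 0 <= \det M.
Proof.
elim: n M r => [|n IHn] M r offM r_gt0 rM_ge0; first by rewrite det_mx00.
pose a := M 0 0.
pose b : 'rV_n := \row_j M 0 (lift 0 j).
pose c : 'cV_n := \col_i M (lift 0 i) 0.
pose D : 'M_n := \matrix_(i, j) M (lift 0 i) (lift 0 j).
pose r' : 'rV_n := \row_j r 0 (lift 0 j).
have rME j : (r *m M) 0 j = r 0 0 * M 0 j + \sum_i r' 0 i * M (lift 0 i) j.
  by rewrite mxE big_ord_recl; congr (_ + _); apply: eq_bigr => i _; rewrite mxE.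
have b_le0 j : M 0 (lift 0 j) <= 0 by apply: offM; rewrite neq_lift.
have c_le0 i : M (lift 0 i) 0 <= 0 by apply: offM; rewrite eq_sym neq_lift.
have r'_gt0 i : 0 < r' 0 i by rewrite mxE.
have rc_le0 : \sum_i r' 0 i * M (lift 0 i) 0 <= 0.
  by apply: sumr_le0 => i _; rewrite pmulr_rle0.
have rM0 := rM_ge0 0; rewrite rME -/a in rM0.
have a_ge0 : 0 <= a.
  by rewrite -(pmulr_rge0 _ (r_gt0 0)); lra.
have ME : M = block_mx a%:M b c D :> 'M_(1 + n).
  apply/matrixP => i j; rewrite !mxE.
  case: splitP => i' ei; rewrite !mxE; case: splitP => j' ej;
    rewrite !mxE ?ord1 ?eqxx ?mulr1n;
    by congr (M _ _); apply: val_inj; rewrite /= ?ei ?ej ?ord1.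
case: (eqVneq a 0) => [a0 | a_neq0].
  (* With [a = 0], entry 0 of [r M] is a sum of nonpositive terms that is nonnegative, so all its
     terms vanish; as [r' > 0], the whole first column of [M] is zero. *)
  have c0 i : M (lift 0 i) 0 = 0.
    have rc0 : \sum_i r' 0 i * - M (lift 0 i) 0 = 0.
      under eq_bigr do rewrite mulrN.
      rewrite sumrN; rewrite a0 in rM0; lra.
    have ge0 k : true -> 0 <= r' 0 k * - M (lift 0 k) 0.
      by move=> _; rewrite pmulr_rge0 ?oppr_ge0.
    have /eqP := @psumr_eq0P _ _ _ _ ge0 rc0 i isT.
    by rewrite mulf_eq0 gt_eqF //= oppr_eq0 => /eqP.
  rewrite ME; have -> : c = 0 by apply/colP => i; rewrite !mxE.
  by rewrite (det_ublock (a%:M : 'M_1)) det_mx11 mxE a0 mulr1n mul0r.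
pose S := D - (a^-1 *: c) *m b.
have -> : \det M = a * \det S.
  have -> : M = block_mx 1%:M 0 (a^-1 *: c) 1%:M *m block_mx a%:M b 0 S
      :> 'M_(1 + n).
    rewrite mulmx_block !mul1mx !mul0mx ?mulmx0 ?addr0 ME; congr block_mx.
      by rewrite mul_mx_scalar scalerA divff // scale1r.
    by rewrite /S addrC subrK.
  rewrite det_mulmx (det_lblock (1%:M : 'M_1)) (det_ublock (a%:M : 'M_1)).
  by rewrite !det1 !mul1r det_mx11 mxE mulr1n.
have SE i j : S i j
    = M (lift 0 i) (lift 0 j) - a^-1 * M (lift 0 i) 0 * M 0 (lift 0 j).
  by rewrite !mxE big_ord_recl big_ord0 addr0 !mxE.
apply: mulr_ge0 => //; apply: (IHn S r') => // [i j neq_ij|j].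
  rewrite SE subr_le0; apply: (@le_trans _ _ 0).
    by apply: offM; rewrite (inj_eq lift_inj).
  by rewrite -mulrA mulr_ge0 ?invr_ge0 // mulr_le0.
(* Eliminating with the pivot subtracts from entry [lift 0 j] of [r M] a nonnegative multiple of the
   nonpositive [M 0 (lift 0 j)]; the multiplier is entry 0 of [r M] divided by [a]. *)
have -> : (r' *m S) 0 j = (r *m M) 0 (lift 0 j)
    - a^-1 * (r 0 0 * a + \sum_i r' 0 i * M (lift 0 i) 0) * M 0 (lift 0 j).
  rewrite rME mxE mulrDr mulrCA mulVf // mulr1 mulrDl opprD addrACA subrr add0r.
  under eq_bigr do rewrite SE mulrBr.
  rewrite sumrB mulr_sumr mulr_suml; congr (_ - _).
  by apply: eq_bigr => i _; rewrite !mulrA [r' 0 i * _]mulrC.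
rewrite subr_ge0; apply: le_trans (rM_ge0 _).
by rewrite mulr_ge0_le0 // mulr_ge0 ?invr_ge0.
Qed.

Lemma det_int_Zmatrix_ge0 (n : nat) (M : 'M[int]_n) (r : 'rV[int]_n) :
  (forall i j, i <> j -> M i j <= 0) -> Rset M r -> 0 <= \det M.
Proof.
move=> offM [r_gt0 rM_ge0]; rewrite -(ler_int rat) -det_map_mx.
apply: (@det_Zmatrix_ge0 _ _ _ (map_mx intr r)) => [i j /eqP ne|i|j].
- by rewrite mxE (ler_int rat _ 0); apply: offM.
- by rewrite mxE (ltr_int rat 0).
- by rewrite -map_mxM mxE (ler_int rat 0); apply: rM_ge0.
Qed.

(** Writing [B = L D R] in Smith form, the class of [u] modulo the row lattice is determined by the
    entries of [u R^-1] modulo the diagonal entries [d_i]. There are [\prod |d_i| = |\det B|] such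
    residue tuples. *)
Lemma size_incongruent_le_det (n : nat) (B : 'M[int]_n) (s : seq 'rV[int]_n) :
  \det B != 0 -> uniq s ->
  {in s &, forall u v z, u - v = z *m B -> u = v} ->
  (size s <= `|\det B|)%N.
Proof.
move=> detB s_uniq s_inc.
have [L uL [R uR [d _ BE]]] := int_Smith_normal_form B.
set D := (X in _ = L *m X *m R) in BE.
have DE : D = diag_mx (\row_i d`_i) by apply/matrixP => i j; rewrite !mxE.
have unit_det (U : 'M[int]_n) : U \in unitmx -> `|\det U|%N = 1%N.
  by rewrite unitmxE => /orP[] /eqP ->.
have detE : `|\det B|%N = (\prod_(i < n) `|(d`_i)%R|)%N.
  rewrite BE !det_mulmx !abszM (unit_det L) // (unit_det R) // mul1n muln1 DE det_diag.
  rewrite (big_morph _ abszM (erefl _)).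
  by apply: eq_bigr => i _; rewrite mxE.
have d_neq0 (i : 'I_n) : d`_i != 0.
  have : (0 < \prod_(i < n) `|(d`_i)%R|)%N by rewrite -detE absz_gt0.
  by rewrite (bigD1 i) //= muln_gt0 absz_gt0 => /andP[].
pose m (u : 'rV[int]_n) (i : 'I_n) := ((u *m invmx R) 0%R i %% d`_i)%Z.
have m_lt u i : (`|m u i| < `|(d`_i)%R|)%N.
  by rewrite -ltz_nat gez0_abs ?modz_ge0 // abszE ltz_mod.
pose res u : {dffun forall i : 'I_n, 'I_(`|(d`_i)%R|%N)} :=
  [ffun i => Ordinal (m_lt u i)].
have res_inj : {in s &, injective res}.
  move=> u v su sv /ffunP eq_res.
  have dvd i : (d`_i %| ((u - v) *m invmx R) 0%R i)%Z.
    rewrite mulmxBl !mxE -eqz_mod_dvd; apply/eqP.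
    have /(congr1 val) := eq_res i; rewrite !ffunE /= => /(congr1 Posz).
    by rewrite !gez0_abs ?modz_ge0 // /m !mxE.
  (* Coordinatewise quotients: [w D = (u - v) R^-1], hence [u - v = (w L^-1) B]. *)
  pose w : 'rV[int]_n := \row_i (((u - v) *m invmx R) 0%R i %/ d`_i)%Z.
  apply: (s_inc u v su sv (w *m invmx L)).
  rewrite BE !mulmxA mulmxKV //.
  have -> : w *m D = (u - v) *m invmx R.
    by apply/rowP => i; rewrite DE mul_mx_diag !mxE divzK //; have := dvd i; rewrite mxE.
  by rewrite mulmxKV.
rewrite -(size_map res) detE.
have /card_uniqP <- : uniq (map res s) by rewrite map_inj_in_uniq.
apply: leq_trans (max_card _) _; rewrite card_dep_ffun foldrE big_image /=.
by apply: eq_leq; apply: eq_bigr => i _; rewrite card_ord.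
Qed.

(* Since [r Delta >= 0], replacing [z] by [z - r] preserves the domination by
   [f]; iterating reduces to [z <= r], where the positive part of [z] lies in
   [Omega r]. *)
Lemma parking_dominated_le0 (n : nat) (Delta : 'M[int]_n) (r : 'rV[int]_n)
    (f : {ffun 'I_n -> nat}) (z : 'rV[int]_n) :
  (forall i j, i <> j -> Delta i j <= 0) ->
  Rset Delta r -> parking_wrt Delta r f ->
  (forall j, (z *m Delta) 0 j <= (f j)%:Z) -> forall i, z 0 i <= 0.
Proof.
move=> offD [r_gt0 rD_ge0] fP.
have [k] : exists k : nat, forall i, z 0 i <= k%:Z * r 0 i.
  (* This [k] works because every entry of [r] is a positive integer, hence at least 1. *)
  exists (\sum_i `|z 0%R i|)%N => i.
  apply: (@le_trans _ _ (\sum_i `|z 0%R i|)%N%:Z).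
    apply: le_trans (ler_norm _) _; rewrite -abszE lez_nat.
    by rewrite (bigD1 i) //= leq_addr.
  by rewrite ler_peMr // -gtz0_ge1.
elim: k z => [|k IHk] z z_le zf.
  by move=> i; rewrite -(mul0r (r 0 i)).
have z_le_r i : z 0 i <= r 0 i.
  have := IHk (z - r); rewrite -subr_le0.
  have -> : z 0 i - r 0 i = (z - r) 0 i by rewrite !mxE.
  apply=> [l|j].
    by have := z_le l; rewrite !mxE intS mulrDl mul1r lerBlDl.
  by apply: le_trans (zf j); rewrite mulmxBl mxE [X in _ + X]mxE gerBl.
move=> i; rewrite leNgt; apply/negP => zi_gt0.
pose chi : 'rV[int]_n := \row_l Num.max (z 0 l) 0.
have [|j [chi_j /andP[_ f_lt]]] := fP chi.
  split=> [l|]; first by rewrite mxE le_max lexx orbT ge_max z_le_r ltW.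
  by exists i; rewrite mxE max_l ?ltW //; apply/eqP; rewrite gt_eqF.
(* At the index [j] given by the parking condition, [chi] and [z] agree. Elsewhere [chi >= z] meets
   a nonpositive entry of column [j], so passing from [z] to [chi] can only lower the product with
   that column, which then cannot exceed [f j]. *)
have zj : chi 0 j = z 0 j.
  by move: chi_j; rewrite mxE; case: (leP (z 0 j) 0).
suff chiD_le : dot chi (col j Delta) <= (z *m Delta) 0 j.
  by have := lt_le_trans f_lt (le_trans chiD_le (zf j)); rewrite ltxx.
rewrite /dot mxE; apply: ler_sum => l _; rewrite [col _ _ _ _]mxE.
case: (eqVneq l j) => [-> | /eqP ne]; first by rewrite zj.
by rewrite ler_wnM2r ?offD // mxE le_max lexx.
Qed.

Lemma parking_incongruent (n : nat) (Delta : 'M[int]_n)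
    (f g : {ffun 'I_n -> nat}) (z : 'rV[int]_n) :
  (forall i j, i <> j -> Delta i j <= 0) ->
  parking_functions Delta f -> parking_functions Delta g ->
  (forall j, (f j)%:Z - (g j)%:Z = (z *m Delta) 0 j) -> f = g.
Proof.
move=> offD [r rR fP] [r' rR' gP] fg.
(* The witnesses [r] and [r'] may differ: each serves for one sign of [z] only. *)
have z_le0 := parking_dominated_le0 (z := z) offD rR fP.
have z_ge0 := parking_dominated_le0 (z := - z) offD rR' gP.
have z0 : z = 0.
  apply/rowP => i; rewrite mxE; apply/eqP; rewrite eq_le z_le0 /= => [|j].
    rewrite -oppr_le0; have := z_ge0 _ i; rewrite mxE; apply=> j.
    by rewrite mulNmx mxE -fg opprB gerBl.
  by rewrite -fg gerBl.
apply/ffunP => j; have := fg j.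
by rewrite z0 mul0mx mxE => /eqP; rewrite subr_eq0 => /eqP[].
Qed.

(** An infinite set would contain a finite subset with more than [N] elements. This allows counting
    on finite families before finiteness of the whole set is known. *)
Lemma fset_set_card_le (T : choiceType) (A : set T) (N : nat) :
  (forall B : {fset T}, [set` B] `<=` A -> (#|` B| <= N)%N) ->
  finite_set A /\ (#|` fset_set A| <= N)%N.
Proof.
move=> bound; have finA : finite_set A.
  apply: contrapT => /(infinite_set_fset N.+1)[B BA].
  by rewrite leqNgt ltnS bound.
by split=> //; apply: bound; rewrite fset_setK.
Qed.

Theorem corollary2p10 (n : nat) (Delta : 'M[int]_n)
    (n_ge1 : (1 <= n)%N)
    (det_neq0 : \det Delta <> 0)
    (offdiag_le0 : forall i j : 'I_n, i <> j -> Delta i j <= 0)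
    (R_nonempty : exists r : 'rV[int]_n, Rset Delta r) :
  finite_set (parking_functions Delta) /\
  (#|` fset_set (parking_functions Delta)|%fset)%:Z <= \det Delta.
Proof.
have [r rR] := R_nonempty.
have [|fin le_card] := @fset_set_card_le _ (parking_functions Delta)
  `|\det Delta|%N; last first.
  by split=> //; rewrite -(ger0_norm (det_int_Zmatrix_ge0 offdiag_le0 rR)) -abszE lez_nat.
move=> B BP; pose vec (f : {ffun 'I_n -> nat}) : 'rV[int]_n := \row_j (f j)%:Z.
have vec_inj : injective vec.
  by move=> f g /rowP eq_fg; apply/ffunP => j; have := eq_fg j; rewrite !mxE => -[].
rewrite -(size_map vec); apply: size_incongruent_le_det; first exact/eqP.
  by rewrite map_inj_uniq // fset_uniq.
move=> _ _ /mapP[f fB ->] /mapP[g gB ->] z fg; congr vec.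
apply: (parking_incongruent offdiag_le0 (BP _ fB) (BP _ gB) (z := z)) => j.
by rewrite -fg !mxE.
Qed.
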